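(* Let $q\ge 2$ be an integer, let $g\geq 2$, and let $P\in\mathbf{P}_g(q)$. Then $$\frac{g}{\eta}\,P(1)=\sum_{n=0}^{g-1}A_n+\sum_{n=0}^{g-2}q^{g-1-n}A_n,$$ where $A_n=A_n(P)$ and $\eta=\eta(P)$ are the quantities attached to $P$ (defined in the context).
   Context: For integers $q\ge2$ and $g\ge 1$, $\mathbf{P}_g(q)$ is the set of polynomials $P\in\mathbb{Z}[t]$ of degree $2g$ such that: (i) $P(t)=q^gt^{2g}P\bigl(\frac1{qt}\bigr)$; (ii) $P(0)=1$ and $P(1)\neq0$. (No condition on the absolute values of the roots is imposed.) For $P\in\mathbf{P}_g(q)$, the integers $A_n=A_n(P)$, $n\ge0$, are the coefficients of the power series $$Z_P(t)=\frac{P(t)}{(1-t)(1-qt)}=\sum_{n=0}^\infty A_nt^n.$$ The map $\omega\mapsto q/\omega$ is a permutation of the inverse roots of $P$ (with multiplicity), and these inverse roots are ordered in a sequence $(\omega_i)_{1\le i\le 2g}$, so that $P(t)=\prod_{i=1}^{2g}(1-\omega_it)$, with $\omega_{g+i}=q/\omega_i$ for $1\le i\le g$. Put $x_i=-(\omega_i+q/\omega_i)$ for $1\le i\le g$. Since $P(1)\ne0$, one has $q+1+x_i\neq0$, and $\eta=\eta(P)$ is defined by $$\frac1\eta=\frac1g\sum_{i=1}^g\frac1{q+1+x_i}$$ (so that $\frac g\eta$ stands for $\sum_{i=1}^g\frac{1}{q+1+x_i}$). *)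

(* Defs.v *)
From HB Require Import structures.
From mathcomp Require Import all_boot all_order all_algebra.

Set Implicit Arguments.
Unset Strict Implicit.
Unset Printing Implicit Defensive.

Import Order.TTheory GRing.Theory Num.Theory.
Local Open Scope ring_scope.

(* The functional equation is an identity of rational functions in 'X. *)
Definition functional_equation (q g : nat) (P : {poly int}) : Prop :=
  let t : {fraction {poly int}} := tofrac 'X in
  let Pt (u : {fraction {poly int}}) := (map_poly intr P).[u] in
  Pt t = q%:R ^+ g * t ^+ (2 * g) * Pt (1 / (q%:R * t)).

Definition in_Pg (q g : nat) (P : {poly int}) : Prop :=
  [/\ size P = (2 * g).+1, functional_equation q g P, P.[0] = 1 & P.[1] != 0].

(* A formal power series over int is given by its coefficients nat -> int. *)
Definition ps_mul (a b : nat -> int) (n : nat) : int :=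
  \sum_(i < n.+1) a i * b (n - i)%N.

Definition ps_poly (p : {poly int}) (n : nat) : int := p`_n.

(* The series 1 / (1 - c t). *)
Definition ps_geom (c : int) (n : nat) : int := c ^+ n.

(* Coefficients of P(t) / ((1 - t) (1 - q t)); see A_coefP and A_coef_unique. *)
Definition A_coef (q : nat) (P : {poly int}) : nat -> int :=
  ps_mul (ps_mul (ps_geom 1) (ps_geom q%:Z)) (ps_poly P).

Definition inverse_roots (C : numClosedFieldType) (q g : nat) (P : {poly int})
    (omega : 'I_(g + g) -> C) : Prop :=
  map_poly intr P = \prod_(i < g + g) (1 - omega i *: 'X) /\
  forall i : 'I_g, omega (rshift g i) = q%:R / omega (lshift g i).

Definition x_of (C : numClosedFieldType) (q g : nat)
    (omega : 'I_(g + g) -> C) (i : 'I_g) : C :=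
  - (omega (lshift g i) + q%:R / omega (lshift g i)).

(* If the sum vanishes, then eta = 0 because 0^-1 = 0, and g / eta is still
   the sum. *)
Definition eta_of (C : numClosedFieldType) (q g : nat)
    (omega : 'I_(g + g) -> C) : C :=
  (1 / g%:R * \sum_(i < g) 1 / (q%:R + 1 + x_of q omega i))^-1.

Lemma g_div_eta (C : numClosedFieldType) (q g : nat)
    (omega : 'I_(g + g) -> C) :
  g%:R / eta_of q omega = \sum_(i < g) 1 / (q%:R + 1 + x_of q omega i).
Proof.
rewrite /eta_of invrK; case: g omega => [|g] omega; first by rewrite big_ord0 mul0r.
by rewrite mulrA div1r divff ?mul1r // pnatr_eq0.
Qed.

Lemma ps_mul_trunc a b N n : (n < N)%N ->
  ps_mul a b n = ((\poly_(i < N) a i) * (\poly_(i < N) b i))`_n.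
Proof.
move=> nN; rewrite coefM; apply: eq_bigr => -[i /= iN] _.
by rewrite !coef_poly (leq_ltn_trans _ nN) ?(leq_ltn_trans (leq_subr _ _) nN).
Qed.

Lemma eq_ps_mul a a' b b' n :
  (forall i, a i = a' i) -> (forall i, b i = b' i) ->
  ps_mul a b n = ps_mul a' b' n.
Proof. by move=> ea eb; apply: eq_bigr => i _; rewrite ea eb. Qed.

Lemma ps_mulA a b c n :
  ps_mul a (ps_mul b c) n = ps_mul (ps_mul a b) c n.
Proof.
pose T (u : nat -> int) := \poly_(i < n.+1) u i.
transitivity ((T a * (T b * T c))`_n).
  rewrite coefM; apply: eq_bigr => -[i /= iN] _.
  by rewrite coef_poly iN -ps_mul_trunc // ltnS leq_subr.
rewrite mulrA coefM; apply: eq_bigr => -[i /= iN] _.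
by rewrite -ps_mul_trunc // coef_poly ltnS leq_subr.
Qed.

Lemma ps_mulC a b n : ps_mul a b n = ps_mul b a n.
Proof. by rewrite !(@ps_mul_trunc _ _ n.+1) // mulrC. Qed.

Lemma ps_polyM p r n :
  ps_poly (p * r) n = ps_mul (ps_poly p) (ps_poly r) n.
Proof. by rewrite /ps_poly coefM. Qed.

Lemma ps_mul1 a n : ps_mul (ps_poly 1) a n = a n.
Proof.
rewrite /ps_mul big_ord_recl /ps_poly coef1 /= mul1r subn0 big1 ?addr0 // => i _.
by rewrite coef1 /= mul0r.
Qed.

Lemma ps_geomP c n :
  ps_mul (ps_poly (1 - c *: 'X)) (ps_geom c) n = ps_poly 1 n.
Proof.
rewrite /ps_mul /ps_poly /ps_geom; case: n => [|n].
  by rewrite big_ord1 !coefE /= mulr0 subr0 mulr1.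
rewrite !big_ord_recl big1 ?addr0 => [|i _]; rewrite !coefE /=.
  by rewrite mulr0 subr0 mul1r mulr1 sub0r subn0 /bump /= subSS subn0 exprS mulNr subrr.
by rewrite mulr0 subr0 mul0r.
Qed.

Lemma A_coefP q (P : {poly int}) n :
  ps_mul (ps_poly ((1 - 'X) * (1 - q%:Z *: 'X))) (A_coef q P) n = P`_n.
Proof.
rewrite /A_coef ps_mulA -[RHS](ps_mul1 (ps_poly P)).
apply: eq_ps_mul => // {}n; set d1 := 1 - 'X; set d2 := 1 - _.
transitivity (ps_mul (ps_mul (ps_poly d1) (ps_geom 1))
                     (ps_mul (ps_poly d2) (ps_geom q%:Z)) n).
  rewrite -ps_mulA; transitivity (ps_mul (ps_poly d1) (ps_mul (ps_poly d2)
     (ps_mul (ps_geom 1) (ps_geom q%:Z))) n).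
    by rewrite [RHS]ps_mulA; apply: eq_ps_mul => // i; rewrite ps_polyM.
  apply: eq_ps_mul => // i; rewrite !ps_mulA.
  by apply: eq_ps_mul => // j; rewrite ps_mulC.
rewrite (@eq_ps_mul _ (ps_poly 1) _ (ps_poly 1)) ?ps_mul1 // => i.
  by rewrite -(ps_geomP 1) scale1r.
exact: ps_geomP.
Qed.

Lemma A_coef_unique q (P : {poly int}) (B : nat -> int) :
  (forall n,
     ps_mul (ps_poly ((1 - 'X) * (1 - q%:Z *: 'X))) B n = P`_n) ->
  forall n, B n = A_coef q P n.
Proof.
move=> BP n; set D := (X in ps_poly X) in BP.
pose Q := ps_mul (ps_geom 1) (ps_geom q%:Z).
have QD i : ps_mul Q (ps_poly D) i = ps_poly 1 i.
  rewrite ps_mulC /ps_poly -(A_coefP q 1); apply: eq_ps_mul => // j.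
  by rewrite /A_coef ps_mulC ps_mul1.
rewrite -[LHS](ps_mul1 B) -(@eq_ps_mul _ _ B B n QD) // -ps_mulA.
exact: eq_ps_mul.
Qed.

(* Main.v *)
(** Since P(t) = \prod_i (1 + x_i t + q t^2), the logarithmic derivative at 1
    gives P'(1) - g P(1) = (q - 1) (g / eta) P(1). On coefficients, writing
    P = \sum_k a_k t^k, the symmetry a_(2g-k) = q^(g-k) a_k folds
    P'(1) - g P(1) = \sum_k (k - g) a_k into
    \sum_(k < g) (g - k) (q^(g-k) - 1) a_k, and this is also q - 1 times the
    weighted sum of the A_n, because
    (q - 1) A_n = \sum_(k <= n) (q^(n+1-k) - 1) a_k. *)

Require Import Defs.
From HB Require Import structures.
From mathcomp Require Import all_boot all_order all_algebra.
From mathcomp Require Import ring zify.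

Set Implicit Arguments.
Unset Strict Implicit.
Unset Printing Implicit Defensive.

Import Order.TTheory GRing.Theory Num.Theory.
Local Open Scope ring_scope.

Lemma horner1_coef (R : nzSemiRingType) (p : {poly R}) n :
  (size p <= n)%N -> p.[1] = \sum_(0 <= k < n) p`_k.
Proof.
move=> pn; rewrite (horner_coef_wide _ pn) big_mkord.
by apply: eq_bigr => k _; rewrite expr1n mulr1.
Qed.

Lemma deriv1_coef (R : nzSemiRingType) (p : {poly R}) n :
  (size p <= n)%N -> p^`().[1] = \sum_(0 <= k < n) p`_k *+ k.
Proof.
case: n => [|n] pn.
  by move: pn; rewrite leqn0 size_poly_eq0 => /eqP->; rewrite linear0 horner0 big_geq.
rewrite big_nat_recl // mulr0n add0r (@horner1_coef _ _ n).
  by apply: eq_bigr => k _; rewrite coef_deriv.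
apply/leq_sizeP => k nk; rewrite coef_deriv nth_default ?mul0rn //.
exact: leq_trans pn _.
Qed.

Lemma deriv_prod_horner (F : fieldType) (I : Type) (r : seq I)
    (f : I -> {poly F}) (t : F) :
  (forall i, (f i).[t] != 0) ->
  (\prod_(i <- r) f i)^`().[t] =
    (\prod_(i <- r) f i).[t] * \sum_(i <- r) (f i)^`().[t] / (f i).[t].
Proof.
move=> f0; elim: r => [|i r IHr]; first by rewrite !big_nil derivC horner0 mulr0.
rewrite !big_cons derivM hornerD !hornerM IHr mulrDr.
congr (_ + _); last by rewrite mulrA.
by field; exact: f0.
Qed.

(** The effect of t -> 1/(at) on the monomial of degree m: the prefactor [t ^+ (i + m)] turns it
    into degree i, and the extra [a ^+ g] clears the denominator [a ^+ m]. *)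
Lemma reflect_monomial (F : fieldType) (a t c : F) (g i m : nat) :
  a != 0 -> t != 0 -> (g + g = i + m)%N ->
  a ^+ g * (a ^+ g * t ^+ (i + m) * (c * (1 / (a * t)) ^+ m)) =
    a ^+ i * c * t ^+ i.
Proof.
move=> a0 t0 gim.
transitivity (a ^+ (g + g) * (t ^+ (i + m) * (c * (1 / (a * t)) ^+ m))).
  by rewrite (exprD a) !mulrA.
rewrite gim !exprD div1r exprVn exprMn.
by field; rewrite !expf_neq0.
Qed.

Lemma coef_symmetry (q g : nat) (P : {poly int}) : (0 < q)%N -> in_Pg q g P ->
  forall k, (k <= g)%N -> P`_(2 * g - k) = q%:Z ^+ (g - k) * P`_k.
Proof.
move=> q0 [sP fP _ _] k kg.
(* [S] is q^g times the right side of the functional equation. That factor makes its coefficients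
   integral, so the identity descends from the fraction field to Z[t] by injectivity of [tofrac]. *)
pose S := \poly_(i < (2 * g).+1) (q%:Z ^+ i * P`_(2 * g - i)).
have PS : q%:Z ^+ g *: P = S.
  apply/eqP; rewrite -tofrac_eq; apply/eqP.
  have polyF (E : nat -> int) : tofrac (\poly_(i < (2 * g).+1) E i) =
      \sum_(i < (2 * g).+1) (E i)%:~R * tofrac 'X ^+ i :> {fraction {poly int}}.
    rewrite poly_def rmorph_sum; apply: eq_bigr => i _.
    by rewrite -mul_polyC -[X in X%:P]intz rmorph_int rmorphM rmorph_int rmorphXn.
  have X0 : tofrac 'X != 0 :> {fraction {poly int}}.
    by rewrite tofrac_eq0 polyX_eq0.
  have qF0 : q%:R != 0 :> {fraction {poly int}}.
    rewrite -(rmorph_nat (@tofrac {poly int})) tofrac_eq0 -polyC_natr polyC_eq0.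
    by rewrite pnatr_eq0 -lt0n.
  have sI : (size (map_poly (intr : int -> {fraction {poly int}}) P) <= (2 * g).+1)%N.
    by rewrite -sP size_poly.
  have PE : tofrac P = (map_poly intr P).[tofrac 'X] :> {fraction {poly int}}.
    rewrite (horner_coef_wide _ sI) -[in LHS](coefK P) sP polyF.
    by apply: eq_bigr => i _; rewrite coef_map.
  rewrite -mul_polyC rmorphM -[X in X%:P]intz rmorph_int rmorph_int /= PE.
  rewrite [X in _ * X]fP (horner_coef_wide _ sI) polyF.
  rewrite (reindex_inj rev_ord_inj) !mulr_sumr; apply: eq_bigr => -[i /= ig] _.
  rewrite coef_map /= subSS; set m := (2 * g - i)%N.
  have -> : (2 * g = i + m)%N by rewrite subnKC // -ltnS.
  rewrite !rmorphM !rmorphXn /= -pmulrn.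
  have gim : (g + g = i + m)%N by rewrite subnKC ?addnn -?mul2n -1?ltnS.
  by rewrite (reflect_monomial _ qF0 X0 gim).
(* This coefficient reads q^g a_(2g-k) = q^(2g-k) a_k, and q^g cancels. *)
have := congr1 (fun p : {poly int} => p`_(2 * g - k)) PS.
rewrite coefZ coef_poly ltnS leq_subr subKn; last by lia.
have -> : (2 * g - k = g + (g - k))%N by lia.
rewrite exprD -mulrA; apply: mulfI.
by apply: expf_neq0; lia.
Qed.

Lemma big_nat_shift (V : nmodType) (k m : nat) (f : nat -> V) :
  (forall n, (n < k)%N -> f n = 0) ->
  \sum_(0 <= n < k + m) f n = \sum_(0 <= j < m) f (k + j)%N.
Proof.
move=> f0; rewrite (big_cat_nat (n := k)) ?leq_addr //=.
rewrite big_nat_cond big1 ?add0r => [|n /andP[/andP[_ nk] _]]; last exact: f0.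
rewrite -[X in \sum_(X <= _ < _) _]add0n big_addn addKn.
by apply: eq_bigr => j _; rewrite addnC.
Qed.

Lemma ps_mul_geom (q n : nat) :
  (q%:Z - 1) * ps_mul (ps_geom 1) (ps_geom q%:Z) n = q%:Z ^+ n.+1 - 1.
Proof.
rewrite ps_mulC subrX1; congr (_ * _); apply: eq_bigr => i _.
by rewrite /ps_geom expr1n mulr1.
Qed.

(* For k > n the truncated exponent n.+1 - k vanishes and so does the term,
   which makes the range of summation independent of n. *)
Lemma A_coef_geom (q : nat) (P : {poly int}) (g n : nat) : (n < g)%N ->
  (q%:Z - 1) * A_coef q P n = \sum_(0 <= k < g) P`_k * (q%:Z ^+ (n.+1 - k) - 1).
Proof.
move=> ng; rewrite /A_coef ps_mulC /ps_mul mulr_sumr.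
rewrite (big_cat_nat (n := n.+1)) //= big_mkord.
rewrite [X in _ = _ + X]big_nat_cond [X in _ = _ + X]big1 => [|k].
  rewrite addr0; apply: eq_bigr => -[k /= kn] _.
  by rewrite mulrCA ps_mul_geom subSn.
by rewrite andbT => /andP[nk _]; rewrite (eqP nk) expr0 subrr mulr0.
Qed.

(** This is the total weight of a_k in (q - 1) times the sum of the A_n. Put g - k = m + 1 and n = k
    + j: for j < m the two sums contribute x^(j+1) - 1 and, after reversal, x^(m+1) - x^(j+1), which
    add up to x^(m+1) - 1. The term j = m of the first sum is one more copy. *)
Lemma sum_geom_weights (R : comPzRingType) (x : R) (k g : nat) : (k <= g)%N ->
  \sum_(0 <= n < g) (x ^+ (n.+1 - k) - 1)
    + \sum_(0 <= n < g.-1) x ^+ (g - 1 - n) * (x ^+ (n.+1 - k) - 1)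
  = (x ^+ (g - k) - 1) *+ (g - k).
Proof.
have z n : (n < k)%N -> x ^+ (n.+1 - k) - 1 = 0.
  by move=> nk; rewrite (eqP nk) expr0 subrr.
move=> /subnKC; case: (g - k)%N => [|m] <-.
  by rewrite !big1_seq ?addr0 // => n; rewrite mem_index_iota => nk;
    rewrite z ?mulr0 //; lia.
rewrite addnS /= -addnS !big_nat_shift => [|n nk|n nk]; rewrite ?z ?mulr0 //.
under eq_bigr do rewrite -addnS addKn.
have -> : \sum_(0 <= j < m) x ^+ (k + m.+1 - 1 - (k + j)) * (x ^+ ((k + j).+1 - k) - 1)
    = \sum_(0 <= j < m) (x ^+ m.+1 - x ^+ j.+1).
  rewrite [RHS]big_nat_rev; apply: eq_big_nat => j /andP[_ jm] /=.
  rewrite -addnS addKn mulrBr mulr1 -exprD add0n.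
  by congr (x ^+ _ - x ^+ _); lia.
rewrite big_nat_recr //= addrAC -big_split /= mulrS addrC; congr (_ + _).
under eq_bigr do rewrite addrC subrKA.
by rewrite sumr_const_nat subn0.
Qed.

Lemma sum_A_coef (q g : nat) (P : {poly int}) :
  (q%:Z - 1) * (\sum_(0 <= n < g) A_coef q P n
     + \sum_(0 <= n < g.-1) q%:Z ^+ (g - 1 - n) * A_coef q P n) =
  \sum_(0 <= k < g) P`_k * (q%:Z ^+ (g - k) - 1) *+ (g - k).
Proof.
transitivity (\sum_(0 <= n < g) \sum_(0 <= k < g) P`_k * (q%:Z ^+ (n.+1 - k) - 1) +
  \sum_(0 <= n < g.-1) \sum_(0 <= k < g)
     P`_k * (q%:Z ^+ (g - 1 - n) * (q%:Z ^+ (n.+1 - k) - 1))).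
  rewrite mulrDr !mulr_sumr; congr (_ + _); apply: eq_big_nat => n /andP[_ ng].
    exact: A_coef_geom.
  rewrite mulrCA (@A_coef_geom _ _ g) ?mulr_sumr; last by lia.
  by apply: eq_bigr => k _; rewrite mulrCA.
rewrite exchange_big_nat [X in _ + X]exchange_big_nat -big_split /=.
apply: eq_big_nat => k /andP[_ kg].
by rewrite -!mulr_sumr -mulrDr sum_geom_weights 1?ltnW // mulrnAr.
Qed.

Lemma deriv_sub_coef (q g : nat) (P : {poly int}) : (0 < q)%N -> in_Pg q g P ->
  P^`().[1] - P.[1] *+ g =
  \sum_(0 <= k < g) P`_k * (q%:Z ^+ (g - k) - 1) *+ (g - k).
Proof.
move=> q0 hP; have [sP _ _ _] := hP.
rewrite (deriv1_coef (eq_leq sP)) (horner1_coef (eq_leq sP)) -sumrMnl -sumrB.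
have -> : (2 * g).+1 = (g + g.+1)%N by rewrite mul2n -addnn addnS.
rewrite (big_cat_nat (n := g)) ?leq_addr //=.
rewrite -[X in \sum_(X <= _ < _ + _) _]add0n big_addn addKn.
(* The middle index k = g has weight k - g = 0; reversing the rest of the upper half pairs k with 2g
   - k. *)
rewrite [X in _ + X]big_nat_recl //= add0n subrr add0r.
rewrite [X in _ + X]big_nat_rev -big_split /=; apply: eq_big_nat => k /andP[_ kg].
have -> : ((0 + g - k.+1).+1 + g = 2 * g - k)%N by lia.
rewrite (coef_symmetry q0 hP) 1?ltnW // -[P`_k *+ k - _]opprB -!mulrnBr; try lia.
have -> : (2 * g - k - g = g - k)%N by lia.
by rewrite addrC -mulrnBl; congr (_ *+ _); ring.
Qed.

(** Each factor contributes (x_i + 2q) / (q + 1 + x_i) - 1 = (q - 1) / (q + 1 + x_i); P(1) != 0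
    makes the denominators nonzero. *)
Lemma prod_quadratic_deriv (F : fieldType) (q : F) (g : nat) (x : 'I_g -> F) :
  let P := \prod_i (1 + x i *: 'X + q *: 'X^2) in
  P.[1] != 0 ->
  P^`().[1] - P.[1] *+ g = (q - 1) * (\sum_i 1 / (q + 1 + x i) * P.[1]).
Proof.
move=> P; pose f i := 1 + x i *: 'X + q *: 'X^2.
have f1 i : (f i).[1] = q + 1 + x i by rewrite /f !hornerE /=; ring.
have f1' i : (f i)^`().[1] = x i + q *+ 2.
  by rewrite /f !derivE /= !hornerE /=; ring.
move=> P1; have f0 i : (f i).[1] != 0.
  by apply: contraNneq P1 => fi0; rewrite horner_prod (bigD1 i) //= fi0 mul0r.
rewrite (deriv_prod_horner _ f0) -/P -[in RHS]mulr_suml [RHS]mulrA [RHS]mulrC.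
rewrite -[P.[1] *+ g]mulr_natr -mulrBr; congr (_ * _).
(* Writing g as a sum of g ones gives each factor its own -1. *)
rewrite -[X in X%:R]card_ord -sumr_const -sumrB mulr_sumr.
apply: eq_bigr => i _; rewrite f1 f1'.
by field; rewrite -f1.
Qed.

(** The factors of omega_i and q/omega_i are multiplied together. Their product has leading
    coefficient q only if omega_i != 0, since division by 0 returns 0. *)
Lemma inverse_roots_quadratic (C : numClosedFieldType) (q g : nat)
    (P : {poly int}) (omega : 'I_(g + g) -> C) :
  size P = (2 * g).+1 -> inverse_roots q P omega ->
  map_poly intr P = \prod_i (1 + x_of q omega i *: 'X + q%:R *: 'X^2).
Proof.
move=> sP [PE om].
(* If some omega i were 0, the product would have at most 2g - 1 factors of
   degree at most 1, contradicting deg P = 2g. *)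
have om0 i : omega i != 0.
  apply/eqP => oi; have := size_poly_prod_leq (fun j => j != i) (fun j => 1 - omega j *: 'X).
  have : (2 * g).+1 = size (\prod_(j | j != i) (1 - omega j *: 'X)).
    rewrite -sP -(size_map_inj_poly (f := intr : int -> C)) ?PE //; last exact: intr_inj.
    by rewrite (bigD1 i) //= oi scale0r subr0 mul1r.
  move=> <-; rewrite cardC1 card_ord.
  have : (\sum_(j < g + g | j != i) size (1 - omega j *: 'X)%R <= \sum_(j < g + g | j != i) 2)%N.
    apply: leq_sum => j _; rewrite (leq_trans (size_polyD _ _)) // size_poly1 size_polyN.
    by rewrite geq_max /= (leq_trans (size_scale_leq _ _)) // size_polyX.
  rewrite sum_nat_const cardC1 card_ord => S1 S2.
  have := leq_trans S2 (leq_sub2r (g + g).-1 (S1 : (_ < ((g + g).-1 * 2).+1)%N)).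
  by have := ltn_ord i; lia.
rewrite PE big_split_ord /= -big_split; apply: eq_bigr => i _ /=.
rewrite om /x_of -!mul_polyC rmorphN rmorphD expr2.
have -> : (q%:R : C)%:P = (omega (lshift g i))%:P * (q%:R / omega (lshift g i))%:P.
  by rewrite -rmorphM mulrCA divff ?mulr1.
by ring.
Qed.

Theorem theorem3p5 (C : numClosedFieldType) (q g : nat)
    (hq : (2 <= q)%N) (hg : (2 <= g)%N)
    (P : {poly int}) (hP : in_Pg q g P)
    (omega : 'I_(g + g) -> C) (homega : inverse_roots q P omega) :
  g%:R / eta_of q omega * (P.[1])%:~R =
    (\sum_(0 <= n < g) A_coef q P n
     + \sum_(0 <= n < g.-1) q%:Z ^+ (g - 1 - n) * A_coef q P n)%:~R.
Proof.
have q0 : (0 < q)%N by exact: ltnW.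
have [sP _ _ P1] := hP.
have PC := inverse_roots_quadratic sP homega.
have P1C : (map_poly intr P).[1] = P.[1]%:~R :> C.
  by rewrite -(rmorph1 intr) horner_map.
have P1C' : (map_poly intr P)^`().[1] = P^`().[1]%:~R :> C.
  by rewrite deriv_map -(rmorph1 intr) horner_map.
(* Both computations of P'(1) - g P(1) carry the factor q - 1, which cancels because q >= 2. *)
have q10 : q%:R - 1 != 0 :> C by rewrite subr_eq0 pnatr_eq1; lia.
apply: (mulfI q10); rewrite g_div_eta mulr_suml -P1C PC.
rewrite -prod_quadratic_deriv -PC P1C ?intr_eq0 // P1C' -rmorphMn -rmorphB /=.
by rewrite (deriv_sub_coef q0 hP) -sum_A_coef rmorphM rmorphB.
Qed.
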